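(* Let $c(t)=(a(t),b(t))$ be a non-degenerate geodesic starting at the origin $o$ of the sub-Riemannian structure $(\mathcal{H},H,g)$ on the $7$-dimensional quaternionic Heisenberg group, with constants $C_5,C_6,C_7$, $C=\sqrt{C_5^2+C_6^2+C_7^2}$ and $D$ as in the context. Then there is a family of geodesics of the same parametrization (the same value of $D$) starting at the origin, containing $c$, all intersecting at the same Maxwell time $T=\frac{2\pi}{C}$ at the Maxwell point (in the coordinates $(a_2,a_3,a_4,b_1,b_2,b_3,b_4)$) $$c(T)=\left[-\frac{2\pi D}{C^3}C_5,\,-\frac{2\pi D}{C^3}C_6,\,-\frac{2\pi D}{C^3}C_7,\,0,0,0,0\right].$$ In particular, the geodesic $c(t)$ is no more optimal after it reaches the time $T$.
   Context: The quaternionic Heisenberg group $\mathcal{H}$ is $\mathbb{R}^7$ with coordinates $(a_2,a_3,a_4,b_1,b_2,b_3,b_4)$; writing $b=b_1+b_2I+b_3J+b_4K$ and $\Im(a)=a_2I+a_3J+a_4K$ (quaternions), the multiplication is $(b,\Im(a))\cdot(d,\Im(c))=(b+d,\Im(a)+\Im(c)-\Im(\bar bd))$, and $o$ is the identity (the origin). The distribution $H$ is spanned by the left-invariant fields $e_1=\partial_{b_1}+b_2\partial_{a_2}+b_3\partial_{a_3}+b_4\partial_{a_4}$, $e_2=\partial_{b_2}-b_1\partial_{a_2}+b_4\partial_{a_3}-b_3\partial_{a_4}$, $e_3=\partial_{b_3}-b_4\partial_{a_2}-b_1\partial_{a_3}+b_2\partial_{a_4}$, $e_4=\partial_{b_4}+b_3\partial_{a_2}-b_2\partial_{a_3}-b_1\partial_{a_4}$,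 and $g$ is the metric on $H$ making them orthonormal. The optimal control problem is to minimize the energy $\frac12\int_0^{T'}\sum_{i=1}^4u_i^2\,dt$ among curves with $\dot c=\sum_{i=1}^4u_ie_i$ joining two fixed points in fixed time $T'$; a geodesic from $o$ is optimal up to time $t$ if its restriction to $[0,t]$ solves this problem between its endpoints. Geodesics are the projections to $\mathcal{H}$ of the solutions of the Pontryagin maximum principle system with Hamiltonian $\frac12(h_1^2+\dots+h_4^2)$. Those starting at $o$ are the curves with $c(0)=o$ and $\dot c(t)=\sum_{i=1}^4h_i(t)e_i(c(t))$, where $h=(h_1,\dots,h_4)^t$ solves $\dot h=\Omega h$ with $$\Omega=\begin{bmatrix}0&-C_5&-C_6&-C_7\\ C_5&0&C_7&-C_6\\ C_6&-C_7&0&C_5\\ C_7&C_6&-C_5&0\end{bmatrix}$$ for real constants $C_5,C_6,C_7$. The geodesic is non-degenerate if $(C_5,C_6,C_7)\neq0$ and $h(0)\neq0$. The constant $D=\|h(0)\|^2=\|h(t)\|^2$ determines the parametrization (arc length for $D=1$). A Maxwell point is a point where two different geodesics (starting at $o$) meet with the same values of the cost functional and time; that time is called a Maxwell time. *)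

(* Defs.v *)
From HB Require Import structures.
From mathcomp Require Import all_boot all_order all_algebra.
From mathcomp Require Import all_classical all_reals all_analysis.

Set Implicit Arguments.
Unset Strict Implicit.
Unset Printing Implicit Defensive.

Import Order.TTheory GRing.Theory Num.Theory.
Import numFieldNormedType.Exports.

Local Open Scope classical_set_scope.
Local Open Scope ring_scope.

Section QuaternionicHeisenberg.
Context {R : realType}.

(* A point of the 7-dimensional quaternionic Heisenberg group is the row
   (a2, a3, a4, b1, b2, b3, b4); the identity element o is 0. *)
Definition point7 (a2 a3 a4 b1 b2 b3 b4 : R) : 'rV[R]_7 :=
  \row_(k < 7) nth 0 [:: a2; a3; a4; b1; b2; b3; b4] k.

(* frame i is the left-invariant vector field e_(i+1).  Left invariance is for
   (b, Im a) . (d, Im c) = (b + d, Im a + Im c - Im (conj b * d)). *)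
Definition frame (i : 'I_4) (x : 'rV[R]_7) : 'rV[R]_7 :=
  let b1 := x 0 (inord 3) in let b2 := x 0 (inord 4) in
  let b3 := x 0 (inord 5) in let b4 := x 0 (inord 6) in
  nth 0 [:: point7   b2     b3     b4   1 0 0 0;
            point7 (- b1)   b4   (- b3) 0 1 0 0;
            point7 (- b4) (- b1)   b2   0 0 1 0;
            point7   b3   (- b2) (- b1) 0 0 0 1] i.

Definition velocity (u : 'cV[R]_4) (x : 'rV[R]_7) : 'rV[R]_7 :=
  \sum_(i < 4) u i 0 *: frame i x.

(* The norm `|u| of the library on matrices is the sup norm; the metric making
   the frame orthonormal gives the Euclidean one. *)
Definition sqnorm (u : 'cV[R]_4) : R := \sum_(i < 4) u i 0 ^+ 2.

Definition abs_continuous (t : R) (x : R -> 'rV[R]_7) : Prop :=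
  forall e : R, 0 < e -> exists2 d : R, 0 < d &
    forall (n : nat) (p q : 'I_n -> R),
      (forall i, 0 <= p i /\ p i <= q i /\ q i <= t) ->
      (forall i j, i != j -> q i <= p j \/ q j <= p i) ->
      \sum_(i < n) (q i - p i) < d ->
      \sum_(i < n) `|x (q i) - x (p i)| < e.

(* Integrability of u on [0, t] follows from the last two clauses, since u is
   almost everywhere the derivative of the last four coordinates of x. *)
Definition horizontal (t : R) (u : R -> 'cV[R]_4) (x : R -> 'rV[R]_7) : Prop :=
  [/\ forall i, measurable_fun `[0, t] (fun s => u s i 0),
      abs_continuous t x &
      {ae (@lebesgue_measure R), forall s, 0 < s < t ->
         is_derive s (1 : R) x (velocity (u s) (x s))}].

Definition energy (t : R) (u : R -> 'cV[R]_4) : \bar R :=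
  ((2^-1)%:E * \int[@lebesgue_measure R]_(s in `[0%R, t]) (sqnorm (u s))%:E)%E.

(* Used for a curve x which is horizontal with control u. *)
Definition optimal_up_to (t : R) (u : R -> 'cV[R]_4) (x : R -> 'rV[R]_7)
    : Prop :=
  forall (v : R -> 'cV[R]_4) (y : R -> 'rV[R]_7),
    horizontal t v y -> y 0 = x 0 -> y t = x t ->
    (energy t u <= energy t v)%E.

Definition Omega (C5 C6 C7 : R) : 'M[R]_4 :=
  \matrix_(i < 4, j < 4) nth 0 (nth [::]
    [:: [:: 0;  - C5; - C6; - C7];
        [:: C5; 0;    C7;   - C6];
        [:: C6; - C7; 0;    C5  ];
        [:: C7; C6;   - C5; 0   ]] i) j.

(* c is the geodesic from o whose control h solves h' = Omega h; the system
   being linear in h, and then triangular in c, its solutions are global. *)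
Definition geodesic (C5 C6 C7 : R) (h : R -> 'cV[R]_4) (c : R -> 'rV[R]_7)
    : Prop :=
  [/\ c 0 = 0,
      forall t : R, is_derive t (1 : R) h (Omega C5 C6 C7 *m h t) &
      forall t : R, is_derive t (1 : R) c (velocity (h t) (c t))].

Definition nondegenerate_extremal (C5 C6 C7 : R) (h : R -> 'cV[R]_4)
    : Prop :=
  (C5, C6, C7) <> (0, 0, 0) /\ h 0 <> 0.

Definition geodesic_of_sqspeed (D : R) (c : R -> 'rV[R]_7) : Prop :=
  exists C5 C6 C7 h, geodesic C5 C6 C7 h c /\ sqnorm (h 0) = D.

Definition maxwell (T : R) (x : 'rV[R]_7) (c1 c2 : R -> 'rV[R]_7) : Prop :=
  exists C5 C6 C7 h1 C5' C6' C7' h2,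
    [/\ geodesic C5 C6 C7 h1 c1 /\ geodesic C5' C6' C7' h2 c2,
        exists2 t, 0 <= t <= T & c1 t <> c2 t,
        c1 T = x /\ c2 T = x &
        energy T h1 = energy T h2].

End QuaternionicHeisenberg.

(* Main.v *)
Require Import Defs.
From mathcomp Require Import all_boot all_order all_algebra.
From mathcomp Require Import all_classical all_reals all_analysis.
From mathcomp Require Import ring lra.
Import Order.TTheory GRing.Theory Num.Theory.
Import numFieldNormedType.Exports.

Set Implicit Arguments.
Unset Strict Implicit.
Unset Printing Implicit Defensive.

Local Open Scope classical_set_scope.
Local Open Scope ring_scope.

(** The matrix [Omega] is antisymmetric and satisfies [Omega ^ 2 = - C ^ 2], so
   [Omega / C] is a complex structure on the plane spanned by [X = h 0] and
   [Omega X], and the control is the rotation [h s = e^(i C s) X] of that plane.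
   Everything takes place over it. For a control [z'(s) X] in the plane the
   last four coordinates of the horizontal lift are [z(s) X], and the first
   three stay on the line through (C5, C6, C7), at an abscissa that measures
   the area swept by [z] ([velocity_planar], [planar_path_lift]). Horizontal
   curves over the plane are thus those of the three-dimensional Heisenberg
   group: plane curves with their length and their swept area.

   Maxwell points. The geodesic lies over a circle run at angular speed [C]. At
   time [T = 2 pi / C] the circle closes up, and the swept area depends only on
   [C] and on the norm of [X]. So all geodesics with the same constants and the
   same speed meet at time [T] ([helix_period]). They have the same energy, as
   the norm of the control is constant. At time [T / 2] each of them lies
   over the point of its circle opposite to the origin, which determines [X]
   ([helix_half_period_inj]), so two different ones are already different on
   [0, T]. The rotations of [X] in its plane give infinitely many of them.

   Loss of optimality. Let [t > T], let [w = 2 pi / t], so that [w < C], and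
   identify the control with [u(s) = e^(i C s)]. Write [K] for the area
   coordinate, [E(v)] for the integral of the squared modulus of [v], and let
   [Q = E + C K]. Among the controls with the integral of [u], the quadratic
   function [Q] is critical at [u], so it changes by exactly [Q(d)] when [u] is
   replaced by [u + d], for [d] of integral zero over [0, t]. For the closed loop
   [d(s) = beta e^(i w s)] this is [t |beta| ^ 2 (1 - C / w) < 0]. If [u + d]
   also has the area coordinate of [u], then it leads to the same point and
   has strictly smaller energy. Equality of the areas is a real equation in
   [beta], with a linear term and a nonzero quadratic one. It has a nonzero
   solution as soon as the linear term is not zero as a function of [beta],
   that is unless [C t] is a multiple of [2 pi]. In that case [u] itself runs
   several times through a closed circle, and the one turn
   [sqrt (w / C) e^(i w s)] around a larger circle sweeps the same area at a
   smaller cost ([shorter_path]). *)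

(** * Curves with a continuous derivative *)

Section Calculus.
Context {R : realType}.

Lemma is_derive_mxP (m n : nat) (M : R -> 'M[R]_(m, n)) (s : R)
    (dM : 'M[R]_(m, n)) :
  is_derive s (1 : R) M dM <->
  forall i j, is_derive s (1 : R) (fun r => M r i j) (dM i j).
Proof.
split=> [[exM <-] i j | dMij].
  have exMij := (derivable_mxP M s 1).1 exM.
  by apply: DeriveDef; [exact: exMij | rewrite (derive_mx exM) mxE].
have exM : derivable M s 1.
  by apply/derivable_mxP => i j; exact: (@ex_derive _ _ _ _ _ _ _ (dMij i j)).
apply: DeriveDef => //; rewrite (derive_mx exM); apply/matrixP => i j.
by rewrite mxE; exact: (@derive_val _ _ _ _ _ _ _ (dMij i j)).
Qed.

Lemma eq_is_derive (f g d : R -> R) :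
  (forall s : R, is_derive s (1 : R) f (d s)) ->
  (forall s : R, is_derive s (1 : R) g (d s)) ->
  f 0 = g 0 -> f =1 g.
Proof.
move=> df dg fg0 s; apply/eqP; rewrite -subr_eq0; apply/eqP.
have dfg : forall r : R, is_derive r (1 : R) (f - g) 0.
  by move=> r; have := is_deriveB (df r) (dg r); rewrite subrr.
have := @is_derive_0_is_cst _ (f - g) s 0 dfg.
by rewrite /= !fctE fg0 subrr.
Qed.

Lemma is_derive_continuous (f d : R -> R) :
  (forall s : R, is_derive s (1 : R) f (d s)) -> continuous f.
Proof.
by move=> df s; apply/differentiable_continuous/derivable1_diffP; exact: ex_derive.
Qed.

Lemma integral_is_derive (F f : R -> R) (t : R) : 0 < t -> continuous f ->
  (forall s : R, is_derive s (1 : R) F (f s)) ->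
  (\int[lebesgue_measure]_(s in `[0%R, t]) (f s)%:E)%E = (F t - F 0)%:E.
Proof.
move=> t0 cf dF; rewrite (continuous_FTC2 (F := F) t0) //.
- exact: continuous_subspaceT.
- have cF := is_derive_continuous dF; split.
  + by move=> s _; exact: (@ex_derive _ _ _ _ _ _ _ (dF s)).
  + exact/cvg_at_right_filter/cF.
  + exact/cvg_at_left_filter/cF.
- by move=> s _; rewrite derive1E; exact: (@derive_val _ _ _ _ _ _ _ (dF s)).
Qed.

(** The source of the absolute continuity that horizontality requires. *)
Lemma is_derive_lipschitz (f d : R -> R) (t : R) : 0 <= t -> continuous d ->
  (forall s : R, is_derive s (1 : R) f (d s)) ->
  exists2 L : R, 0 <= L &
    forall p q, 0 <= p -> p <= q -> q <= t -> `|f q - f p| <= L * (q - p).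
Proof.
move=> t0 cd df.
have cnd : {within `[0, t], continuous (fun s => `|d s|)}.
  by apply: continuous_subspaceT => s; apply: cvg_norm; exact: cd.
have [m _ dm] := EVT_max t0 cnd.
exists `|d m| => // p q p0 pq qt.
have [|s] := MVT_segment (f := f) pq (fun x _ => df x).
  exact/continuous_subspaceT/(is_derive_continuous df).
rewrite in_itv /= => /andP[ps sq] ->; rewrite normrM (ger0_norm (x := q - p)) ?subr_ge0 //.
by rewrite ler_wpM2r ?subr_ge0 // dm // in_itv /= (le_trans p0 ps) (le_trans sq qt).
Qed.

End Calculus.

(** * The frame in coordinates *)

Section Frame.
Context {R : realType}.

Lemma sum4E (V : nmodType) (F : 'I_4 -> V) :
  \sum_(i < 4) F i = F (inord 0) + F (inord 1) + F (inord 2) + F (inord 3).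
Proof.
rewrite !big_ord_recl big_ord0 addr0 !addrA.
by congr (F _ + F _ + F _ + F _); apply: val_inj; rewrite /= inordK.
Qed.

(** Indices are put in the form [inord k], the one in which the frame reads its
   coordinates. *)
Lemma ord4P (P : 'I_4 -> Prop) :
  P (inord 0) -> P (inord 1) -> P (inord 2) -> P (inord 3) -> forall i, P i.
Proof.
move=> P0 P1 P2 P3 i; rewrite -(inord_val i).
by case: i => -[|[|[|[|]]]].
Qed.

Lemma ord7P (P : 'I_7 -> Prop) :
  P (inord 0) -> P (inord 1) -> P (inord 2) -> P (inord 3) ->
  P (inord 4) -> P (inord 5) -> P (inord 6) -> forall i, P i.
Proof.
move=> P0 P1 P2 P3 P4 P5 P6 i; rewrite -(inord_val i).
by case: i => -[|[|[|[|[|[|[|]]]]]]].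
Qed.

Lemma velocityE (u : 'cV[R]_4) (x : 'rV[R]_7) :
  let b1 := x 0 (inord 3) in let b2 := x 0 (inord 4) in
  let b3 := x 0 (inord 5) in let b4 := x 0 (inord 6) in
  let u1 := u (inord 0) 0 in let u2 := u (inord 1) 0 in
  let u3 := u (inord 2) 0 in let u4 := u (inord 3) 0 in
  velocity u x = point7 (u1 * b2 - u2 * b1 - u3 * b4 + u4 * b3)
                        (u1 * b3 + u2 * b4 - u3 * b1 - u4 * b2)
                        (u1 * b4 - u2 * b3 + u3 * b2 - u4 * b1) u1 u2 u3 u4.
Proof.
move=> b1 b2 b3 b4 u1 u2 u3 u4; rewrite /velocity sum4E.
rewrite -/u1 -/u2 -/u3 -/u4 /frame -/b1 -/b2 -/b3 -/b4 !inordK //=.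
by apply/rowP; apply: ord7P; rewrite !mxE !inordK //=; ring.
Qed.

Lemma point7E (a2 a3 a4 b1 b2 b3 b4 : R) :
  let x := point7 a2 a3 a4 b1 b2 b3 b4 in
  (x 0 (inord 0) = a2) * (x 0 (inord 1) = a3) * (x 0 (inord 2) = a4) *
  (x 0 (inord 3) = b1) * (x 0 (inord 4) = b2) * (x 0 (inord 5) = b3) *
  (x 0 (inord 6) = b4).
Proof. by move=> x; rewrite /x !mxE !inordK. Qed.

Lemma sqnormE (u : 'cV[R]_4) :
  sqnorm u = u (inord 0) 0 ^+ 2 + u (inord 1) 0 ^+ 2 + u (inord 2) 0 ^+ 2
             + u (inord 3) 0 ^+ 2.
Proof. exact: sum4E. Qed.

Lemma OmegaE (C5 C6 C7 : R) (u : 'cV[R]_4) :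
  let u1 := u (inord 0) 0 in let u2 := u (inord 1) 0 in
  let u3 := u (inord 2) 0 in let u4 := u (inord 3) 0 in
  let v := Omega C5 C6 C7 *m u in
  (v (inord 0) 0 = - C5 * u2 - C6 * u3 - C7 * u4) *
  (v (inord 1) 0 = C5 * u1 + C7 * u3 - C6 * u4) *
  (v (inord 2) 0 = C6 * u1 - C7 * u2 + C5 * u4) *
  (v (inord 3) 0 = C7 * u1 + C6 * u2 - C5 * u3).
Proof.
move=> u1 u2 u3 u4 v.
by do !split; rewrite /v mxE sum4E !mxE !inordK //= -/u1 -/u2 -/u3 -/u4; ring.
Qed.

(** A pointwise solution with continuous control has a continuous velocity, which
   is bounded on the compact interval; the curve is therefore Lipschitz there. *)
Lemma C1_horizontal (t : R) (u : R -> 'cV[R]_4) (x : R -> 'rV[R]_7) :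
  0 <= t -> (forall i, continuous (fun s => u s i 0)) ->
  (forall s : R, is_derive s (1 : R) x (velocity (u s) (x s))) ->
  horizontal t u x.
Proof.
move=> t0 cu dx; split.
- move=> i; apply: measurable_funTS; exact: measurable_realfun.continuous_measurable_fun.
- have dxj j := fun s => (is_derive_mxP _ _ _).1 (dx s) 0 j.
  have cx j := is_derive_continuous (dxj j).
  have cd : forall j, continuous (fun s => velocity (u s) (x s) 0 j).
    have cB (f g : R -> R) : continuous f -> continuous g ->
      continuous (fun s => f s - g s).
      by move=> cf cg s; apply: continuousB; [exact: cf | exact: cg].
    have cD (f g : R -> R) : continuous f -> continuous g ->
      continuous (fun s => f s + g s).
      by move=> cf cg s; apply: continuousD; [exact: cf | exact: cg].
    have cux i k : continuous (fun s => u s i 0 * x s 0 k).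
      by move=> s; apply: continuousM; [exact: cu | exact: cx].
    apply: ord7P; under eq_fun do rewrite velocityE point7E; try exact: cu.
    + exact: (cD _ _ (cB _ _ (cB _ _ (cux _ _) (cux _ _)) (cux _ _)) (cux _ _)).
    + exact: (cB _ _ (cB _ _ (cD _ _ (cux _ _) (cux _ _)) (cux _ _)) (cux _ _)).
    + exact: (cB _ _ (cD _ _ (cB _ _ (cux _ _) (cux _ _)) (cux _ _)) (cux _ _)).
  have /choice[L L_ge0] : forall j, exists L : R, 0 <= L /\
      forall p q, 0 <= p -> p <= q -> q <= t -> `|x q 0 j - x p 0 j| <= L * (q - p).
    by move=> j; have [L] := is_derive_lipschitz t0 (cd j) (dxj j); exists L.
  pose M := \sum_j L j.
  have M0 : 0 <= M by apply: sumr_ge0 => j _; exact: (L_ge0 j).1.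
  have xM p q : 0 <= p -> p <= q -> q <= t -> `|x q - x p| <= M * (q - p).
    move=> p0 pq qt; rewrite [leLHS]/Num.Def.normr /= mx_normrE.
    apply: bigmax_le => [|[i j] _]; first by rewrite mulr_ge0 // subr_ge0.
    rewrite !mxE /= ord1; apply: le_trans ((L_ge0 j).2 _ _ p0 pq qt) _.
    rewrite ler_wpM2r ?subr_ge0 // /M (bigD1 j) //= lerDl.
    by apply: sumr_ge0 => k _; exact: (L_ge0 k).1.
  (* M + 1 rather than M, which may be zero. *)
  move=> e e0; exists (e / (M + 1)); first by rewrite divr_gt0 // ltr_wpDl.
  move=> n p q pq _ pqd.
  apply: (@le_lt_trans _ _ (M * \sum_(i < n) (q i - p i))).
    by rewrite mulr_sumr; apply: ler_sum => i _; have [p0 [? ?]] := pq i; exact: xM.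
  have S0 : 0 <= \sum_(i < n) (q i - p i).
    by apply: sumr_ge0 => i _; rewrite subr_ge0; have [_ []] := pq i.
  move: pqd; rewrite ltr_pdivlMr ?ltr_wpDl // mulrC; apply: le_lt_trans.
  by rewrite ler_wpM2r // lerDl.
- by apply: aeW => s _; exact: dx.
Qed.

End Frame.

(** * Plane curves: area and cost *)

Section PlanarPaths.
Context {R : realType}.

(** The data of a horizontal curve over a plane: velocity [(f, g)], position
   [(F, G)], and the two quantities that integrate along the curve, namely [K],
   which is minus twice the area swept from the origin, and [N], twice the
   energy. Giving the primitives explicitly makes every later computation a
   differentiation. *)
Record planar_path (f g F G K N : R -> R) : Prop := PlanarPath {
  path_start : [/\ F 0 = 0, G 0 = 0, K 0 = 0 & N 0 = 0];
  path_continuous : continuous f /\ continuous g;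
  path_abscissa : forall s : R, is_derive s (1 : R) F (f s);
  path_ordinate : forall s : R, is_derive s (1 : R) G (g s);
  path_area : forall s : R, is_derive s (1 : R) K (f s * G s - g s * F s);
  path_cost : forall s : R, is_derive s (1 : R) N (f s ^+ 2 + g s ^+ 2)
}.

(** The velocity is [p e^(i C s) + (x + i y) e^(i w s)]. The terms of frequency
   [C - w] in the area and the cost are the interaction of the two rotations. *)
Lemma two_circles_path (p x y C w : R) : C != 0 -> w != 0 -> C - w != 0 ->
  planar_path
    (fun s => p * cos (C * s) + x * cos (w * s) - y * sin (w * s))
    (fun s => p * sin (C * s) + x * sin (w * s) + y * cos (w * s))
    (fun s => p * sin (C * s) / C + (x * sin (w * s) + y * (cos (w * s) - 1)) / w)
    (fun s => p * (1 - cos (C * s)) / C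
              + (x * (1 - cos (w * s)) + y * sin (w * s)) / w)
    (fun s => p ^+ 2 * (sin (C * s) / C - s) / C
      + (x ^+ 2 + y ^+ 2) * (sin (w * s) / w - s) / w
      - p / C * (x * (sin ((C - w) * s) / (C - w) - sin (w * s) / w)
          + y * ((1 - cos ((C - w) * s)) / (C - w) + (1 - cos (w * s)) / w))
      - p / w * (x * (sin ((C - w) * s) / (C - w) - sin (C * s) / C)
          + y * ((1 - cos ((C - w) * s)) / (C - w) - (1 - cos (C * s)) / C)))
    (fun s => (p ^+ 2 + x ^+ 2 + y ^+ 2) * s
      + 2 * p * (x * sin ((C - w) * s) + y * (1 - cos ((C - w) * s))) / (C - w)).
Proof.
move=> C0 w0 d0; split.
- by rewrite !mulr0 sin0 cos0; split; ring.
- by split=> s; apply/differentiable_continuous/derivable1_diffP; exact: ex_derive.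
- by move=> s; apply: is_derive_eq; rewrite /GRing.scale /=; field; rewrite C0 w0.
- by move=> s; apply: is_derive_eq; rewrite /GRing.scale /=; field; rewrite C0 w0.
- move=> s; apply: is_derive_eq; rewrite /GRing.scale /=.
  rewrite !mulrBl !cosB !sinB.
  have hC := cos2Dsin2 (C * s); have hw := cos2Dsin2 (w * s).
  move: (cos (C * s)) (sin (C * s)) (cos (w * s)) (sin (w * s)) hC hw.
  move=> c S cw Sw hC hw.
  (* The two sides agree up to multiples of c^2 + S^2 - 1 and cw^2 + Sw^2 - 1. *)
  apply/eqP; rewrite -subr_eq0; apply/eqP.
  transitivity (p ^+ 2 / C * (c ^+ 2 + S ^+ 2 - 1)
     + (x ^+ 2 + y ^+ 2) / w * (cw ^+ 2 + Sw ^+ 2 - 1)).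
    by field; rewrite C0 w0 d0.
  by rewrite hC hw subrr !mulr0 addr0.
- move=> s; apply: is_derive_eq; rewrite /GRing.scale /=.
  rewrite !mulrBl !cosB !sinB.
  have hC := cos2Dsin2 (C * s); have hw := cos2Dsin2 (w * s).
  move: (cos (C * s)) (sin (C * s)) (cos (w * s)) (sin (w * s)) hC hw.
  move=> c S cw Sw hC hw.
  apply/eqP; rewrite -subr_eq0; apply/eqP.
  transitivity (p ^+ 2 * (1 - (c ^+ 2 + S ^+ 2))
     + (x ^+ 2 + y ^+ 2) * (1 - (cw ^+ 2 + Sw ^+ 2))).
    by field; rewrite d0.
  by rewrite hC hw subrr !mulr0 addr0.
Qed.

Lemma circle_path (C : R) : C != 0 ->
  planar_path (fun s => cos (C * s)) (fun s => sin (C * s))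
    (fun s => sin (C * s) / C) (fun s => (1 - cos (C * s)) / C)
    (fun s => (sin (C * s) / C - s) / C) id.
Proof.
move=> C0; split.
- by rewrite !mulr0 sin0 cos0; split; ring.
- by split=> s; apply/differentiable_continuous/derivable1_diffP; exact: ex_derive.
- by move=> s; apply: is_derive_eq; rewrite /GRing.scale /=; field.
- by move=> s; apply: is_derive_eq; rewrite /GRing.scale /=; field.
- move=> s; apply: is_derive_eq; rewrite /GRing.scale /=.
  apply/eqP; rewrite -subr_eq0; apply/eqP.
  transitivity ((cos (C * s) ^+ 2 + sin (C * s) ^+ 2 - 1) / C); first by field.
  by rewrite cos2Dsin2 subrr mul0r.
- by move=> s; rewrite cos2Dsin2; exact: is_derive_id.
Qed.

(** The circle of angular speed [C] run for more than one turn is beaten, with the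
   same end point and the same area, by the perturbation of frequency
   [w = 2 pi / t]: this perturbation closes up at time [t], and the area gained
   per unit of cost is larger because [w < C]. *)
Lemma shorter_path (C t : R) : 0 < C -> 2 * pi / C < t ->
  exists f g F G K N : R -> R,
    [/\ planar_path f g F G K N,
        F t = sin (C * t) / C, G t = (1 - cos (C * t)) / C,
        K t = (sin (C * t) / C - t) / C & N t < t].
Proof.
move=> C0 Tt; pose w := 2 * pi / t.
have t0 : 0 < t by apply: lt_trans Tt; rewrite divr_gt0 // mulr_gt0 // pi_gt0.
have w0 : 0 < w by rewrite divr_gt0 // mulr_gt0 // pi_gt0.
have wC : w < C by move: Tt; rewrite /w !ltr_pdivrMr // [t * C]mulrC.
have d0 : 0 < C - w by rewrite subr_gt0.
have wt : w * t = pi *+ 2 by rewrite /w divfK ?gt_eqF // mulr_natl.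
have swt : sin (w * t) = 0 by rewrite wt sin2pi.
have cwt : cos (w * t) = 1 by rewrite wt cos2pi.
have path p x y := two_circles_path p x y (lt0r_neq0 C0) (lt0r_neq0 w0) (lt0r_neq0 d0).
have cdt : cos ((C - w) * t) = cos (C * t).
  by rewrite mulrBl cosB swt cwt mulr0 mulr1 addr0.
have sdt : sin ((C - w) * t) = sin (C * t).
  by rewrite mulrBl sinB swt cwt mulr0 mulr1 subr0.
(* When C t is a multiple of 2 pi, a single larger circle replaces the whole
   curve; equality of the areas forces its squared speed to be w / C. *)
have [c1|c1] := eqVneq (cos (C * t)) 1.
  have s0 : sin (C * t) = 0.
    apply/eqP; rewrite -sqrf_eq0; apply/eqP.
    by have := cos2Dsin2 (C * t); rewrite c1; lra.
  pose x := Num.sqrt (w / C).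
  have x2 : x ^+ 2 = w / C by rewrite sqr_sqrtr // divr_ge0 // ltW.
  do 6 eexists; split; first exact: (path 0 x 0); cbv beta;
    rewrite ?swt ?cwt ?cdt ?sdt ?s0 ?c1.
  - by ring.
  - by ring.
  - by rewrite x2; field; rewrite !gt_eqF.
  - rewrite x2 expr0n /= add0r addr0 !(mulr0, mul0r, addr0).
    by rewrite -[ltRHS]mul1r ltr_pM2r // ltr_pdivrMr // mul1r.
(* The linear term of the area constraint is proportional to
   x sin (C t) + y (1 - cos (C t)). The perturbation is taken along the gradient
   of this form, and mu is the factor for which the quadratic term cancels the
   linear one. *)
pose mu := 2 * w / (C * (C - w) * t).
have mu0 : 0 < mu by rewrite /mu divr_gt0 // mulr_gt0 // mulr_gt0.
pose x := - mu * sin (C * t); pose y := - mu * (1 - cos (C * t)).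
do 6 eexists; split; first exact: (path 1 x y); cbv beta;
  rewrite ?swt ?cwt ?cdt ?sdt.
- by field; rewrite !gt_eqF.
- by field; rewrite !gt_eqF.
- by rewrite /x /y /mu; field; rewrite !gt_eqF.
- rewrite [ltLHS](_ : _ = t - 2 / C * mu *
      (sin (C * t) ^+ 2 + (1 - cos (C * t)) ^+ 2)); last first.
    by rewrite /x /y /mu; field; rewrite !gt_eqF.
  rewrite ltrBlDr ltrDl mulr_gt0 //.
    by rewrite mulr_gt0 // divr_gt0.
  by rewrite ltr_wpDl ?sqr_ge0 // exprn_even_gt0 //= subr_eq0 eq_sym.
Qed.

End PlanarPaths.

(** * Uniqueness of geodesics *)

Section Uniqueness.
Context {R : realType} (C5 C6 C7 : R).
Local Notation Om := (Omega C5 C6 C7).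

Lemma sqnorm_eq0 (u : 'cV[R]_4) : sqnorm u = 0 -> u = 0.
Proof.
move=> /psumr_eq0P u0; apply/colP => i; rewrite mxE.
by apply/eqP; rewrite -sqrf_eq0 u0 // => j _; exact: sqr_ge0.
Qed.

(** Antisymmetry of [Omega] makes the norm of the difference of two solutions
   constant. *)
Lemma extremal_unique (h k : R -> 'cV[R]_4) :
  (forall s : R, is_derive s (1 : R) h (Om *m h s)) ->
  (forall s : R, is_derive s (1 : R) k (Om *m k s)) ->
  h 0 = k 0 -> h =1 k.
Proof.
move=> dh dk hk0 s; apply/eqP; rewrite -subr_eq0; apply/eqP/sqnorm_eq0.
have dhi i r := (is_derive_mxP _ _ _).1 (dh r) i 0.
have dki i r := (is_derive_mxP _ _ _).1 (dk r) i 0.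
suff /(@is_derive_0_is_cst _ _ s 0) -> :
    forall r : R, is_derive r (1 : R) (fun q => sqnorm (h q - k q)) 0.
  by rewrite hk0 subrr sqnormE !mxE; ring.
move=> r; under eq_fun do rewrite sqnormE !mxE.
by apply: is_derive_eq; rewrite /GRing.scale /= !OmegaE; ring.
Qed.

(** The system is triangular: the last four coordinates are primitives of the
   control, and the first three are primitives of functions of these. *)
Lemma horizontal_lift_unique (u : R -> 'cV[R]_4) (x y : R -> 'rV[R]_7) :
  (forall s : R, is_derive s (1 : R) x (velocity (u s) (x s))) ->
  (forall s : R, is_derive s (1 : R) y (velocity (u s) (y s))) ->
  x 0 = y 0 -> x =1 y.
Proof.
move=> dx dy xy0.
have dxj j r := (is_derive_mxP _ _ _).1 (dx r) 0 j.
have dyj j r := (is_derive_mxP _ _ _).1 (dy r) 0 j.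
have step j : (forall r, velocity (u r) (x r) 0 j = velocity (u r) (y r) 0 j) ->
    forall r, x r 0 j = y r 0 j.
  move=> vxy; apply: (@eq_is_derive _ _ _ _ (dxj j)); last by rewrite xy0.
  by move=> r; rewrite vxy; exact: dyj.
(* The last four components of the velocity do not involve the point. *)
have e3 : forall r, x r 0 (inord 3) = y r 0 (inord 3).
  by apply: step => r; rewrite !velocityE !point7E.
have e4 : forall r, x r 0 (inord 4) = y r 0 (inord 4).
  by apply: step => r; rewrite !velocityE !point7E.
have e5 : forall r, x r 0 (inord 5) = y r 0 (inord 5).
  by apply: step => r; rewrite !velocityE !point7E.
have e6 : forall r, x r 0 (inord 6) = y r 0 (inord 6).
  by apply: step => r; rewrite !velocityE !point7E.
suff xy j : forall r, x r 0 j = y r 0 j by move=> r; apply/rowP.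
by move: j; apply: ord7P => //; apply: step => r; rewrite !velocityE !point7E e3 e4 e5 e6.
Qed.

End Uniqueness.

(** * Geodesics over the plane of the initial control *)

Section Geodesics.
Context {R : realType} (C5 C6 C7 C : R).
Context (C_neq0 : C != 0) (C_sq : C ^+ 2 = C5 ^+ 2 + C6 ^+ 2 + C7 ^+ 2).
Local Notation Om := (Omega C5 C6 C7).

(** The vector [(f + i g) X] for the complex structure [Omega / C]. *)
Definition planar_vec (f g : R) (X : 'cV[R]_4) : 'cV[R]_4 :=
  f *: X + (g / C) *: (Om *m X).

(** On [X] and [(Omega / C) X] the three area forms of the group take the values
   [sqnorm X / C] times C5, C6 and C7: hence the scale of the first three
   coordinates. *)
Definition planar_point (K F G : R) (X : 'cV[R]_4) : 'rV[R]_7 :=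
  let b := planar_vec F G X in let k := K * sqnorm X / C in
  point7 (k * C5) (k * C6) (k * C7)
         (b (inord 0) 0) (b (inord 1) 0) (b (inord 2) 0) (b (inord 3) 0).

Lemma planar_vecE f g X (i : 'I_4) : planar_vec f g X i 0 = f * X i 0 + g / C * (Om *m X) i 0.
Proof. by rewrite /planar_vec [LHS]mxE [in X in X + _]mxE [in X in _ + X]mxE. Qed.

Lemma Omega_sq (X : 'cV[R]_4) : Om *m (Om *m X) = - C ^+ 2 *: X.
Proof.
by apply/colP; apply: ord4P; rewrite !OmegaE !mxE C_sq; ring.
Qed.

Lemma Omega_planar_vec f g X : Om *m planar_vec f g X = C *: planar_vec (- g) f X.
Proof.
rewrite /planar_vec mulmxDr -!scalemxAr Omega_sq scalerDr !scalerA addrC.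
by congr (_ *: _ + _ *: _); field.
Qed.

(** [X] and [(Omega / C) X] are orthogonal and have the same norm. *)
Lemma sqnorm_planar_vec f g X : sqnorm (planar_vec f g X) = (f ^+ 2 + g ^+ 2) * sqnorm X.
Proof.
rewrite !sqnormE !planar_vecE !OmegaE.
rewrite [RHS](_ : _ = f ^+ 2 * sqnorm X + (g / C) ^+ 2 * (C ^+ 2 * sqnorm X)).
  by rewrite C_sq sqnormE; ring.
by rewrite -sqnormE; field.
Qed.

(** Since the values of the area forms on the plane have the fixed direction
   (C5, C6, C7), the three constraints on the centre reduce to a single one, the
   area swept in the plane. *)
Lemma velocity_planar f g K F G X :
  velocity (planar_vec f g X) (planar_point K F G X) = planar_point (f * G - g * F) f g X.
Proof.
rewrite velocityE !point7E !planar_vecE !OmegaE /planar_point !planar_vecE !OmegaE sqnormE.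
by congr point7; field.
Qed.

Lemma is_derive_planar_vec (f g : R -> R) (df dg : R) X (s : R) :
  is_derive s (1 : R) f df -> is_derive s (1 : R) g dg ->
  is_derive s (1 : R) (fun r => planar_vec (f r) (g r) X) (planar_vec df dg X).
Proof.
move=> dff dgg; apply/is_derive_mxP => i j; rewrite ord1 planar_vecE.
under eq_fun do rewrite planar_vecE.
by apply: is_derive_eq; rewrite /GRing.scale /=; ring.
Qed.

Lemma planar_path_lift (f g F G K N : R -> R) X :
  planar_path f g F G K N -> forall s : R,
  is_derive s (1 : R) (fun r => planar_point (K r) (F r) (G r) X)
    (velocity (planar_vec (f s) (g s) X) (planar_point (K s) (F s) (G s) X)).
Proof.
move=> [_ _ dF dG dK _] s; rewrite velocity_planar.
have db i := (is_derive_mxP _ _ _).1 (is_derive_planar_vec X (dF s) (dG s)) i 0.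
have dk k : is_derive s (1 : R) (fun r => K r * sqnorm X / C * k)
    ((f s * G s - g s * F s) * sqnorm X / C * k).
  by have dKs := dK s; apply: is_derive_eq; rewrite /GRing.scale /=; ring.
apply/is_derive_mxP => i j; rewrite ord1 {i}.
by move: j; apply: ord7P; rewrite point7E; under eq_fun do rewrite point7E.
Qed.

Lemma planar_vec10 X : planar_vec 1 0 X = X.
Proof. by rewrite /planar_vec mul0r scale0r addr0 scale1r. Qed.

Lemma planar_point0 X : planar_point 0 0 0 X = 0.
Proof.
by apply/rowP; apply: ord7P; rewrite point7E ?planar_vecE [RHS]mxE; ring.
Qed.

(** The lift of the circle of [circle_path]. *)
Definition helix (X : 'cV[R]_4) (s : R) : 'rV[R]_7 :=
  planar_point ((sin (C * s) / C - s) / C)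
    (sin (C * s) / C) ((1 - cos (C * s)) / C) X.

Lemma helix_geodesic X :
  geodesic C5 C6 C7 (fun s => planar_vec (cos (C * s)) (sin (C * s)) X) (helix X).
Proof.
have [[F0 G0 K0 _] _ _ _ _ _] := circle_path C_neq0.
split.
- by rewrite /helix K0 F0 G0 planar_point0.
- move=> s; rewrite Omega_planar_vec //.
  have -> : C *: planar_vec (- sin (C * s)) (cos (C * s)) X =
            planar_vec (- sin (C * s) * C) (cos (C * s) * C) X.
    by apply/colP => i; rewrite [LHS]mxE !planar_vecE; ring.
  have dcos : is_derive s (1 : R) (fun r => cos (C * r)) (- sin (C * s) * C).
    by apply: is_derive_eq; rewrite /GRing.scale /= mulr1.
  have dsin : is_derive s (1 : R) (fun r => sin (C * r)) (cos (C * s) * C).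
    by apply: is_derive_eq; rewrite /GRing.scale /= mulr1.
  exact: (is_derive_planar_vec X dcos dsin).
- exact: (planar_path_lift X (circle_path C_neq0)).
Qed.

Lemma geodesicE (h : R -> 'cV[R]_4) (c : R -> 'rV[R]_7) :
  geodesic C5 C6 C7 h c ->
  (h = fun s => planar_vec (cos (C * s)) (sin (C * s)) (h 0)) /\ c = helix (h 0).
Proof.
move=> [c0 dh dc]; have [x0 dk dx] := helix_geodesic (h 0).
have hE : h =1 fun s => planar_vec (cos (C * s)) (sin (C * s)) (h 0).
  by apply: (extremal_unique dh dk); rewrite mulr0 cos0 sin0 planar_vec10.
split; apply/funext => //; apply: (horizontal_lift_unique dc); last by rewrite c0 x0.
by move=> s; rewrite (hE s).
Qed.

Lemma energy_planar_path (f g F G K N : R -> R) X (t : R) : 0 < t ->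
  planar_path f g F G K N ->
  energy t (fun s => planar_vec (f s) (g s) X) = (2^-1 * (N t * sqnorm X))%:E.
Proof.
move=> t0 [[_ _ _ N0] [cf cg] _ _ _ dN]; rewrite /energy EFinM; congr (_ * _)%E.
under eq_integral => s _ do rewrite sqnorm_planar_vec //.
have dND s : is_derive s (1 : R) (fun r => N r * sqnorm X)
    ((f s ^+ 2 + g s ^+ 2) * sqnorm X).
  by apply: is_derive_eq; rewrite /GRing.scale /=; ring.
rewrite (integral_is_derive t0 _ dND) ?N0 ?mul0r ?subr0 // => s.
apply: cvgM; last exact: cvg_cst.
by apply: cvgD; [exact: (cvgM (cf s) (cf s)) | exact: (cvgM (cg s) (cg s))].
Qed.

Lemma planar_path_horizontal (f g F G K N : R -> R) X (t : R) : 0 <= t ->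
  planar_path f g F G K N ->
  horizontal t (fun s => planar_vec (f s) (g s) X) (fun s => planar_point (K s) (F s) (G s) X).
Proof.
move=> t0 path; have [_ [cf cg] _ _ _ _] := path; apply: C1_horizontal => //.
- move=> i; under eq_fun do rewrite planar_vecE.
  move=> s; apply: cvgD; apply: cvgM; try exact: cvg_cst; first exact: cf.
  by apply: cvgM; [exact: cg | exact: cvg_cst].
- exact: (planar_path_lift X path).
Qed.

Lemma helix_period X :
  helix X (2 * pi / C) = point7 (- (2 * pi * sqnorm X / C ^+ 3) * C5)
    (- (2 * pi * sqnorm X / C ^+ 3) * C6) (- (2 * pi * sqnorm X / C ^+ 3) * C7) 0 0 0 0.
Proof.
have CT : C * (2 * pi / C) = pi *+ 2 by rewrite mulrC divfK // mulr_natl.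
rewrite /helix CT sin2pi cos2pi /planar_point !planar_vecE.
by congr point7; field.
Qed.

(** Half way the position in the last four coordinates is [(2 / C ^ 2) Omega X],
   and [Omega] is invertible. *)
Lemma helix_half_period_inj X Y : helix X (pi / C) = helix Y (pi / C) -> X = Y.
Proof.
have CT : C * (pi / C) = pi by rewrite mulrC divfK.
rewrite /helix CT sinpi cospi => eXY.
pose b Z := planar_vec (0 / C) ((1 - -1) / C) Z.
have e : b X = b Y.
  move/rowP: eXY => e; apply/colP; apply: ord4P.
  - by have := e (inord 3); rewrite !point7E.
  - by have := e (inord 4); rewrite !point7E.
  - by have := e (inord 5); rewrite !point7E.
  - by have := e (inord 6); rewrite !point7E.
have {e} := congr1 (mulmx Om) e; rewrite /b.
rewrite !Omega_planar_vec // /planar_vec mul0r mul0r !scale0r !addr0 !scalerA.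
by apply: scalerI; rewrite mulf_neq0 // oppr_eq0 mulf_neq0 ?invr_eq0.
Qed.

Lemma planar_vec_inj X f g f' g' : X != 0 -> planar_vec f g X = planar_vec f' g' X -> f = f'.
Proof.
move=> X0 e.
have : sqnorm (planar_vec (f - f') (g - g') X) = 0.
  have -> : planar_vec (f - f') (g - g') X = planar_vec f g X - planar_vec f' g' X.
    by rewrite /planar_vec mulrBl !scalerBl opprD addrACA.
  by rewrite e subrr sqnormE !mxE; ring.
rewrite sqnorm_planar_vec // => /eqP; rewrite mulf_eq0 => /orP[|]; last first.
  by move=> /eqP /sqnorm_eq0 X_eq0; rewrite X_eq0 eqxx in X0.
by rewrite paddr_eq0 ?sqr_ge0 // => /andP[]; rewrite sqrf_eq0 subr_eq0 => /eqP.
Qed.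

Definition helices (D : R) : set (R -> 'rV[R]_7) :=
  [set x | exists2 X, sqnorm X = D & x = helix X].

(** The rational parametrization of the unit circle gives infinitely many
   rotations of [X] in its plane. *)
Lemma helices_infinite (X : 'cV[R]_4) : X != 0 -> infinite_set (helices (sqnorm X)).
Proof.
move=> X0.
pose q (n : nat) : R := n%:R.
have q1 n : 0 < 1 + q n ^+ 2 by rewrite ltr_pwDl // sqr_ge0.
pose f n := (1 - q n ^+ 2) / (1 + q n ^+ 2).
pose g n := 2 * q n / (1 + q n ^+ 2).
pose phi n := helix (planar_vec (f n) (g n) X).
have phi_inj : injective phi.
  move=> m n /(congr1 (@^~ (pi / C))) /helix_half_period_inj /(planar_vec_inj X0).
  have fE k : f k = 2 / (1 + q k ^+ 2) - 1 by rewrite /f; field; rewrite gt_eqF.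
  have two_neq0 : (2 : R) != 0 by rewrite pnatr_eq0.
  rewrite !fE => /addIr /(mulfI two_neq0) /invr_inj /addrI /eqP.
  by rewrite eqrXn2 ?ler0n // eqr_nat => /eqP.
apply: (@sub_infinite_set _ (range phi)).
  move=> _ [n _ <-]; exists (planar_vec (f n) (g n) X) => //.
  by rewrite sqnorm_planar_vec // (_ : _ + _ = 1) ?mul1r // /f /g; field; rewrite gt_eqF.
have /card_eqPle[_] := inj_card_eq (in2W phi_inj : {in [set: nat] &, injective phi}).
by move/infiniteP.
Qed.

Lemma helices_maxwell D x y : 0 < C ->
  helices D x -> helices D y -> x <> y ->
  maxwell (2 * pi / C) (point7 (- (2 * pi * D / C ^+ 3) * C5)
    (- (2 * pi * D / C ^+ 3) * C6) (- (2 * pi * D / C ^+ 3) * C7) 0 0 0 0) x y.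
Proof.
move=> C0 [X XD ->] [Y YD ->] xy; have p0 := pi_gt0 R.
have T0 : 0 < 2 * pi / C by rewrite divr_gt0 // mulr_gt0.
exists C5, C6, C7, (fun s => planar_vec (cos (C * s)) (sin (C * s)) X).
exists C5, C6, C7, (fun s => planar_vec (cos (C * s)) (sin (C * s)) Y).
split; first by split; exact: helix_geodesic.
- exists (pi / C); last by move=> /helix_half_period_inj e; apply: xy; rewrite e.
  by rewrite ltW ?divr_gt0 //= ler_pM2r ?invr_gt0 // ler_peMl ?ltW //; lra.
- by rewrite !helix_period XD YD.
- by rewrite !(energy_planar_path _ T0 (circle_path C_neq0)) XD YD.
Qed.

Lemma not_optimal_after_period h c t : 0 < C -> geodesic C5 C6 C7 h c -> h 0 != 0 ->
  2 * pi / C < t -> ~ optimal_up_to t h c.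
Proof.
move=> C0 hc; have [] := geodesicE hc; move: (h 0) => X -> -> X0 Tt {hc h c}.
have [f [g [F [G [K [N [path Ft Gt Kt Nt]]]]]]] := shorter_path C0 Tt.
have t0 : 0 < t by apply: lt_trans Tt; rewrite divr_gt0 // mulr_gt0 // pi_gt0.
have D0 : 0 < sqnorm X.
  rewrite lt_neqAle eq_sym sumr_ge0 ?andbT => [|i _]; last exact: sqr_ge0.
  by apply: contra_neq X0; exact: sqnorm_eq0.
have [[F0 G0 K0 _] _ _ _ _ _] := path.
move=> /(_ _ _ (planar_path_horizontal X (ltW t0) path)); rewrite /helix.
rewrite Ft Gt Kt F0 G0 K0 => /(_ _ erefl).
rewrite [X in X = _ -> _]planar_point0 !mulr0 sin0 cos0 !subrr mul0r subrr mul0r planar_point0.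
move=> /(_ erefl); apply/negP.
rewrite (energy_planar_path _ t0 path) (energy_planar_path _ t0 (circle_path C_neq0)) lee_fin.
by rewrite -ltNge ltr_pM2l // ltr_pM2r // Nt.
Qed.

End Geodesics.

Theorem proposition6 (R : realType) (C5 C6 C7 : R)
    (h : R -> 'cV[R]_4) (c : R -> 'rV[R]_7) :
  geodesic C5 C6 C7 h c ->
  nondegenerate_extremal C5 C6 C7 h ->
  let C := Num.sqrt (C5 ^+ 2 + C6 ^+ 2 + C7 ^+ 2) in
  let D := sqnorm (h 0) in
  let T := 2 * pi / C in
  let P := point7 (- (2 * pi * D / C ^+ 3) * C5)
                  (- (2 * pi * D / C ^+ 3) * C6)
                  (- (2 * pi * D / C ^+ 3) * C7) 0 0 0 0 in
  (exists F : set (R -> 'rV[R]_7),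
     [/\ F c,
         infinite_set F,
         (forall x, F x -> geodesic_of_sqspeed D x /\ x T = P) &
         (forall x y, F x -> F y -> x <> y -> maxwell T P x y)]) /\
  (forall t, T < t -> ~ optimal_up_to t h c).
Proof.
move=> hc [C567 /eqP h0] C D T P.
have C_sq : C ^+ 2 = C5 ^+ 2 + C6 ^+ 2 + C7 ^+ 2 by rewrite sqr_sqrtr // !addr_ge0 ?sqr_ge0.
have C_gt0 : 0 < C.
  rewrite lt_neqAle sqrtr_ge0 andbT eq_sym; apply/eqP => C0; apply: C567.
  move: C_sq; rewrite C0 expr0n /= => /esym/eqP.
  rewrite !paddr_eq0 ?addr_ge0 ?sqr_ge0 // !sqrf_eq0.
  by move=> /andP[/andP[/eqP-> /eqP->] /eqP->].
have C_neq0 := lt0r_neq0 C_gt0.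
have [hE cE] := geodesicE C_neq0 C_sq hc.
split; last by move=> t; exact: (not_optimal_after_period C_neq0 C_sq C_gt0 hc h0).
exists (helices C5 C6 C7 C D); split.
- by exists (h 0).
- exact: helices_infinite.
- move=> x [X XD ->]; split; last by rewrite helix_period // XD.
  exists C5, C6, C7, (fun s => planar_vec C5 C6 C7 C (cos (C * s)) (sin (C * s)) X).
  split; first exact: helix_geodesic.
  by rewrite mulr0 cos0 sin0 planar_vec10.
- by move=> x y; exact: helices_maxwell.
Qed.
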